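(* Let $k\geq 1$ be an integer and let $z\in\mathbb C$ with $z\neq\phi$, $z\neq -\frac{1}{\phi}$, and $z\neq \frac{F_n}{F_{n-1}}$ for every $n\in\mathbb Z$ (whenever $F_{n-1}\neq 0$). Then (i) $\mathscr F_{2k}\!\left(-\frac{1}{z}\right)=z^{2k}\,\mathscr F_{2k}(z)$; (ii) $\mathscr F_{2k}(1-z)=\mathscr F_{2k}(z)$.
   Context: The Fibonacci numbers are defined by $F_0=0$, $F_1=1$, $F_n=F_{n-1}+F_{n-2}$ for $n>1$, and extended to negative indices by $F_{-n}=(-1)^{n-1}F_n$ for $n\geq 1$ (so the recursion $F_n=F_{n-1}+F_{n-2}$ holds for all $n\in\mathbb Z$). Let $\phi=\frac{1+\sqrt5}{2}$ be the golden ratio. For an integer $m>1$ and $z\in\mathbb C$ with $z\neq\phi,-\frac1\phi$ and $z\neq F_n/F_{n-1}$ for all $n\in\mathbb Z$, the Fibonacci–Eisenstein series is $$\mathscr F_m(z)=\sum_{j=-\infty}^{\infty}\left(F_j z+F_{j-1}\right)^{-m},$$ a bilateral series which converges absolutely on this domain. *)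

(* Defs.v *)
(* Stdlib reals, with Coquelicot's complex numbers and series. *)
From Stdlib Require Import Reals ZArith.
From Coquelicot Require Import Coquelicot.

Fixpoint fib (n : nat) : Z :=
  match n with
  | O => 0%Z
  | S m => match m with
           | O => 1%Z
           | S p => (fib m + fib p)%Z
           end
  end.

Definition fibZ (n : Z) : Z :=
  if (0 <=? n)%Z then fib (Z.to_nat n)
  else ((-1) ^ (- n - 1) * fib (Z.to_nat (- n)))%Z.

Definition fibC (n : Z) : C := RtoC (IZR (fibZ n)).

Definition golden : R := ((1 + sqrt 5) / 2)%R.

(* The two halves (j >= 0 and j < 0) are required to converge separately. *)
Definition is_bilateral_series (a : Z -> C) (s : C) : Prop :=
  exists sp sn : C,
    is_series (V := C_NormedModule) (fun n : nat => a (Z.of_nat n)) sp /\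
    is_series (V := C_NormedModule) (fun n : nat => a (- Z.of_nat (S n))%Z) sn /\
    s = (sp + sn)%C.

(* Meaningful only when the series converges, in the same way as [RInt]. *)
Definition bilateral_series (a : Z -> C) : C :=
  iota (T := CompleteNormedModule.CompleteSpace _ C_CompleteNormedModule)
       (is_bilateral_series a).

Lemma is_bilateral_series_unique (a : Z -> C) (s : C) :
  is_bilateral_series a s -> bilateral_series a = s.
Proof.
intros Hs.
assert (U : forall t, is_bilateral_series a t -> s = t).
{ intros t (tp & tn & Hp & Hn & ->).
  destruct Hs as (sp & sn & Kp & Kn & ->).
  f_equal.
  - exact (filterlim_locally_unique (V := C_NormedModule) _ _ _ Kp Hp).
  - exact (filterlim_locally_unique (V := C_NormedModule) _ _ _ Kn Hn). }
symmetry; apply U.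
exact (iota_correct (V := C_CompleteNormedModule) (is_bilateral_series a)
         (ex_intro _ s (conj Hs U))).
Qed.

Definition fibonacci_eisenstein (m : nat) (z : C) : C :=
  bilateral_series (fun j : Z => (/ ((fibC j * z + fibC (j - 1)) ^ m))%C).

(* Main.v *)
(** With a_j(z) = F_j z + F_{j-1}, the reflection F_{-j} = (-1)^{j-1} F_j gives
    a_j(-1/z) = ± a_{1-j}(z) / z and a_j(1-z) = ± a_{-j}(z), so for even
    exponents both identities are reindexings of the bilateral series.
    Convergence follows from Binet's formula: a_j(z) grows like phi^j as
    j -> +oo unless z = -1/phi, and the second reflection carries this to
    j -> -oo, where the exceptional point is z = phi. *)

Require Import Defs.
From Stdlib Require Import Reals ZArith Lia Lra.
From Coquelicot Require Import Coquelicot.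

(** * Fibonacci numbers at negative indices *)

(** This is $(-1)^{n-1}$, given by parity because the power on [Z] is 0 at negative exponents. *)
Definition fib_sign (n : Z) : Z := if Z.even n then (-1)%Z else 1%Z.

Lemma fib_sign_succ (n : Z) : fib_sign (n + 1) = (- fib_sign n)%Z.
Proof.
unfold fib_sign; rewrite Z.even_add; simpl.
now destruct (Z.even n).
Qed.

Lemma fib_sign_opp (n : Z) : fib_sign (- n) = fib_sign n.
Proof. now unfold fib_sign; rewrite Z.even_opp. Qed.

Lemma fib_sign_sqr (n : Z) : (fib_sign n * fib_sign n = 1)%Z.
Proof. now unfold fib_sign; destruct (Z.even n). Qed.

Lemma pow_opp1_pred (n : nat) : ((-1) ^ Z.of_nat n = fib_sign (Z.of_nat n + 1))%Z.
Proof.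
induction n as [|n IH]; [reflexivity|].
rewrite Nat2Z.inj_succ, Z.pow_succ_r, IH by lia.
unfold Z.succ; rewrite (fib_sign_succ (Z.of_nat n + 1)); ring.
Qed.

Lemma fibZ_nat (n : nat) : fibZ (Z.of_nat n) = fib n.
Proof.
unfold fibZ; destruct (Z.leb_spec 0 (Z.of_nat n)); [|lia].
now rewrite Nat2Z.id.
Qed.

(** For positive [n] this unfolds the definition; negative [n] follows because the sign is an even
    function of the index and squares to 1. *)
Lemma fibZ_opp (n : Z) : fibZ (- n) = (fib_sign n * fibZ n)%Z.
Proof.
assert (P : forall p : nat,
  fibZ (- Z.of_nat (S p)) = (fib_sign (Z.of_nat (S p)) * fibZ (Z.of_nat (S p)))%Z).
{ intros p; rewrite fibZ_nat; unfold fibZ at 1.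
  destruct (Z.leb_spec 0 (- Z.of_nat (S p))); [lia|].
  rewrite Z.opp_involutive, Nat2Z.id.
  replace (Z.of_nat (S p) - 1)%Z with (Z.of_nat p) by lia.
  rewrite pow_opp1_pred; do 2 f_equal; lia. }
destruct (Z.lt_trichotomy n 0) as [H | [-> | H]].
- replace n with (- Z.of_nat (S (Z.to_nat (- n - 1))))%Z by lia.
  rewrite P, fib_sign_opp, Z.mul_assoc, fib_sign_sqr, Z.opp_involutive; lia.
- reflexivity.
- now replace n with (Z.of_nat (S (Z.to_nat (n - 1)))) by lia.
Qed.

Lemma fibZ_rec (n : Z) : fibZ (n + 1) = (fibZ n + fibZ (n - 1))%Z.
Proof.
assert (P : forall p : Z, (1 <= p)%Z -> fibZ (p + 1) = (fibZ p + fibZ (p - 1))%Z).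
{ intros p Hp.
  replace (p + 1)%Z with (Z.of_nat (S (S (Z.to_nat (p - 1))))) by lia.
  replace (fibZ p) with (fibZ (Z.of_nat (S (Z.to_nat (p - 1))))) by (f_equal; lia).
  replace (fibZ (p - 1)) with (fibZ (Z.of_nat (Z.to_nat (p - 1)))) by (f_equal; lia).
  now rewrite !fibZ_nat. }
destruct (Z.lt_trichotomy n 0) as [H | [-> | H]].
(* For negative [n], the recurrence at [- n] is reflected term by term; the alternating signs turn
   it into the recurrence at [n]. *)
- pose proof (P (- n)%Z ltac:(lia)) as E.
  replace (- n + 1)%Z with (- (n - 1))%Z in E by lia.
  replace (- n - 1)%Z with (- (n + 1))%Z in E by lia.
  rewrite !fibZ_opp, fib_sign_succ in E.
  replace (fib_sign (n - 1)) with (- fib_sign n)%Z in E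
    by (replace n with (n - 1 + 1)%Z at 1 by lia; rewrite fib_sign_succ; lia).
  unfold fib_sign in E; destruct (Z.even n); lia.
- reflexivity.
- apply P; lia.
Qed.

(** * The linear forms $F_j z + F_{j-1}$ and their symmetries *)

Definition fib_lin (z : C) (j : Z) : C := (fibC j * z + fibC (j - 1))%C.

Definition signC (n : Z) : C := RtoC (IZR (fib_sign n)).

Lemma signC_sqr (n : Z) : (signC n * signC n = 1)%C.
Proof. now unfold signC; rewrite <- RtoC_mult, <- mult_IZR, fib_sign_sqr. Qed.

Lemma fibC_opp (n : Z) : fibC (- n) = (signC n * fibC n)%C.
Proof. now unfold fibC, signC; rewrite fibZ_opp, mult_IZR, RtoC_mult. Qed.

Lemma signC_succ (n : Z) : signC (n + 1) = (- signC n)%C.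
Proof. now unfold signC; rewrite fib_sign_succ, opp_IZR, RtoC_opp. Qed.

Lemma signC_pred (n : Z) : signC (n - 1) = (- signC n)%C.
Proof. replace n with (n - 1 + 1)%Z at 2 by lia; rewrite signC_succ; ring. Qed.

Lemma fibC_rec (n : Z) : fibC (n + 1) = (fibC n + fibC (n - 1))%C.
Proof. now unfold fibC; rewrite fibZ_rec, plus_IZR, RtoC_plus. Qed.

Lemma fib_lin_0 (z : C) : fib_lin z 0 = 1.
Proof. unfold fib_lin; change (0 * z + 1 = 1)%C; ring. Qed.

Lemma fib_lin_1 (z : C) : fib_lin z 1 = z.
Proof. unfold fib_lin; change (1 * z + 0 = z)%C; ring. Qed.

Lemma fib_lin_rec (z : C) (j : Z) :
  fib_lin z (j + 1) = (fib_lin z j + fib_lin z (j - 1))%C.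
Proof.
unfold fib_lin; rewrite fibC_rec.
replace (j + 1 - 1)%Z with (j - 1 + 1)%Z at 1 by lia.
rewrite fibC_rec; ring.
Qed.

(** By the recurrence the left side is $F_{j+1} - F_j z$, and reflecting the indices $j$ and $j+1$
    introduces opposite signs. *)
Lemma fib_lin_compl (z : C) (j : Z) :
  fib_lin (1 - z) j = (- signC j * fib_lin z (- j))%C.
Proof.
unfold fib_lin.
replace (- j - 1)%Z with (- (j + 1))%Z by lia.
rewrite !fibC_opp, signC_succ, fibC_rec.
(* The factor 1 is inserted as a squared sign, so that [ring] can match the signs coming from the
   reflection. *)
transitivity ((signC j * signC j) *
  (fibC j * (1 - z) + fibC (j - 1)))%C; [rewrite signC_sqr; ring | ring].
Qed.

(** Over the denominator $z$ the left side is $(F_{j-1} z - F_j)/z$, whose coefficients are, up to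
    sign, those at the reflected indices $1-j$ and $-j$. *)
Lemma fib_lin_opp_inv (z : C) (j : Z) :
  z <> 0 -> fib_lin (- / z) j = (- signC j * fib_lin z (1 - j) / z)%C.
Proof.
intros Hz; unfold fib_lin.
replace (1 - j)%Z with (- (j - 1))%Z by lia.
replace (- (j - 1) - 1)%Z with (- j)%Z by lia.
rewrite !fibC_opp, signC_pred.
transitivity ((signC j * signC j) * (fibC j * (- / z) + fibC (j - 1)))%C;
  [rewrite signC_sqr; ring | field; exact Hz].
Qed.

(** This is where evenness of the exponent enters: it erases the signs in both symmetries. *)
Lemma Cpow_even_sign (e w : C) (k : nat) :
  (e * e = 1)%C -> ((- e * w) ^ (2 * k) = w ^ (2 * k))%C.
Proof.
intros He; rewrite !Cpow_mult_r; f_equal.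
transitivity ((e * e) * w ^ 2)%C; [ring | rewrite He; ring].
Qed.

(** * Binet's formula, growth and convergence *)

Lemma golden_sqr : (golden * golden = golden + 1)%R.
Proof.
unfold golden; pose proof (sqrt_sqrt 5 ltac:(lra)); nra.
Qed.

Lemma golden_gt1 : (1 < golden < 2)%R.
Proof.
assert (H : (0 < golden)%R) by (unfold golden; pose proof (sqrt_pos 5); lra).
pose proof golden_sqr; split; nra.
Qed.

Lemma opp_inv_golden : (- / RtoC golden = 1 - RtoC golden)%C.
Proof.
pose proof golden_gt1; pose proof golden_sqr.
rewrite <- RtoC_inv, <- RtoC_opp, <- RtoC_minus by lra; f_equal.
apply (Rmult_eq_reg_r golden); [field_simplify; nra | lra].
Qed.

(** The roots of $x^2 = x + 1$ are $p$ and $1-p$, so this combination of consecutive terms is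
    geometric of ratio $p$; its initial value comes from the forms 1 and $z$ at indices 0 and 1. *)
Lemma fib_lin_step (p z : C) (n : nat) : (p * p = p + 1)%C ->
  (fib_lin z (Z.of_nat n + 1) - (1 - p) * fib_lin z (Z.of_nat n)
   = p ^ n * (z - (1 - p)))%C.
Proof.
intros Hp; induction n as [|n IH].
- change (Z.of_nat 0 + 1)%Z with 1%Z; change (Z.of_nat 0) with 0%Z.
  rewrite fib_lin_0, fib_lin_1; simpl; ring.
- change (p ^ S n)%C with (p * p ^ n)%C.
  replace (Z.of_nat (S n)) with (Z.of_nat n + 1)%Z by lia.
  rewrite <- Cmult_assoc, <- IH, (fib_lin_rec z (Z.of_nat n + 1)).
  replace (Z.of_nat n + 1 - 1)%Z with (Z.of_nat n) by lia.
  transitivity ((fib_lin z (Z.of_nat n + 1) * p +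
    (p * p - p) * fib_lin z (Z.of_nat n)))%C; [rewrite Hp; ring | ring].
Qed.

(** Subtracting the geometric identities for the two roots eliminates the term of index $n+1$ and
    leaves the factor $2\phi - 1 = \sqrt5$. *)
Lemma fib_lin_binet (z : C) (n : nat) :
  ((2 * golden - 1)%R * fib_lin z (Z.of_nat n)
   = golden ^ n * (z - (1 - golden)) - (1 - golden) ^ n * (z - golden))%C.
Proof.
assert (Hp : (RtoC golden * golden = golden + 1)%C)
  by (now rewrite <- RtoC_mult, golden_sqr, RtoC_plus).
pose proof (fib_lin_step golden z n Hp) as E1.
assert (Hq : ((1 - RtoC golden) * (1 - golden) = (1 - golden) + 1)%C).
{ transitivity (1 - 2 * golden + RtoC golden * golden)%C; [ring | rewrite Hp; ring]. }
pose proof (fib_lin_step (1 - golden)%C z n Hq) as E2.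
replace (1 - (1 - RtoC golden))%C with (RtoC golden) in E2 by ring.
rewrite <- E1, <- E2, RtoC_minus, RtoC_mult; ring.
Qed.

(** In Binet's formula the coefficient of $\phi^n$ is $z + 1/\phi \neq 0$, while the other term
    stays bounded because $|1-\phi| \le 1$. *)
Lemma fib_lin_growth (z : C) : z <> (- / RtoC golden)%C ->
  exists (c : R) (N : nat), (0 < c)%R /\
    forall n : nat, (N <= n)%nat -> (c * golden ^ n <= Cmod (fib_lin z (Z.of_nat n)))%R.
Proof.
intros Hz; rewrite opp_inv_golden in Hz.
pose proof golden_gt1 as G.
set (A := Cmod (z - (1 - golden))); set (B := Cmod (z - golden)).
assert (HA : (0 < A)%R).
{ apply Cmod_gt_0; intros E; apply Hz.
  transitivity (z - (1 - golden) + (1 - golden))%C; [ring | rewrite E; ring]. }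
assert (HB : (0 <= B)%R) by apply Cmod_ge_0.
(* From [N] on, the bounded term is at most half of the dominant one; dividing the remaining half by
   $\sqrt5$ gives the constant [A / (2 * D)]. *)
destruct (Pow_x_infinity golden ltac:(rewrite Rabs_pos_eq; lra) (2 * B / A)) as [N HN].
set (D := (2 * golden - 1)%R) in *.
assert (HD : (0 < D)%R) by (unfold D; lra).
exists (A / (2 * D))%R, N; split.
{ apply Rdiv_lt_0_compat; lra. }
intros n Hn.
assert (Hpow : (0 < golden ^ n)%R) by (apply pow_lt; lra).
specialize (HN n Hn); rewrite Rabs_pos_eq in HN by lra.
assert (H2 : (2 * B <= golden ^ n * A)%R).
{ apply Rge_le in HN; apply (Rmult_le_compat_r A) in HN; [|lra].
  now replace (2 * B / A * A)%R with (2 * B)%R in HN by (field; lra). }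
assert (E1 : Cmod (golden ^ n * (z - (1 - golden))) = (golden ^ n * A)%R).
{ now rewrite Cmod_mult, Cmod_pow, Cmod_R, Rabs_pos_eq by lra. }
assert (E2 : (Cmod ((1 - golden) ^ n * (z - golden)) <= B)%R).
{ rewrite Cmod_mult, Cmod_pow, <- RtoC_minus, Cmod_R; fold B.
  rewrite <- (Rmult_1_l B) at 2; apply Rmult_le_compat_r; [exact HB|].
  assert (Hr : (Rabs (1 - golden) <= 1)%R) by (apply Rabs_le; lra).
  pose proof (pow_incr _ 1 n (conj (Rabs_pos (1 - golden)) Hr)) as P.
  now rewrite pow1 in P. }
assert (E3 : (D * Cmod (fib_lin z (Z.of_nat n)) >=
  Cmod (golden ^ n * (z - (1 - golden))) - Cmod ((1 - golden) ^ n * (z - golden)))%R).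
{ replace (D * Cmod (fib_lin z (Z.of_nat n)))%R
    with (Cmod (RtoC D * fib_lin z (Z.of_nat n)))
    by (rewrite Cmod_mult, Cmod_R, Rabs_pos_eq; lra).
  unfold D; rewrite fib_lin_binet.
  set (u := (golden ^ n * _)%C); set (v := ((1 - golden) ^ n * _)%C).
  pose proof (Cmod_triangle (u - v) v) as T.
  replace (u - v + v)%C with u in T by ring; lra. }
apply (Rmult_le_reg_l D); [exact HD|].
replace (D * (A / (2 * D) * golden ^ n))%R with (golden ^ n * A / 2)%R by (field; lra).
lra.
Qed.

(** Comparison with a geometric series of ratio $\phi^{-m} < 1$. *)
Lemma ex_series_fib_lin (m : nat) (z : C) : (1 <= m)%nat -> z <> (- / RtoC golden)%C ->
  ex_series (V := C_NormedModule) (fun n : nat => (/ fib_lin z (Z.of_nat n) ^ m)%C).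
Proof.
intros Hm Hz; destruct (fib_lin_growth z Hz) as (c & N & Hc & H).
pose proof golden_gt1 as G.
(* The growth bound starts at [N]; the finitely many earlier terms do not affect convergence. *)
apply (ex_series_incr_n (V := C_NormedModule) _ N).
apply (ex_series_le (V := C_CompleteNormedModule) _
  (fun n => (/ (c * golden ^ N) ^ m * (/ golden ^ m) ^ n)%R)).
- intros n; change (Cmod (/ fib_lin z (Z.of_nat (N + n)) ^ m)
    <= / (c * golden ^ N) ^ m * (/ golden ^ m) ^ n)%R.
  specialize (H (N + n)%nat ltac:(lia)).
  assert (P : (0 < c * golden ^ (N + n))%R)
    by (apply Rmult_lt_0_compat; [|apply pow_lt]; lra).
  assert (NZ : fib_lin z (Z.of_nat (N + n)) <> 0) by (apply Cmod_gt_0; lra).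
  rewrite Cmod_inv, Cmod_pow by (now apply Cpow_nz).
  rewrite pow_inv, <- Rinv_mult, <- pow_mult, Nat.mul_comm, pow_mult, <- Rpow_mult_distr.
  rewrite Rmult_assoc, <- pow_add.
  apply Rinv_le_contravar; [now apply pow_lt|].
  apply pow_incr; lra.
- apply (ex_series_scal_l (V := R_NormedModule)).
  apply ex_series_geom.
  assert (P : (1 < golden ^ m)%R) by (apply Rlt_pow_R1; [lra | lia]).
  rewrite Rabs_pos_eq by (left; apply Rinv_0_lt_compat; lra).
  rewrite <- Rinv_1; apply Rinv_lt_contravar; lra.
Qed.

(** * Operations on bilateral series *)

Lemma is_bilateral_series_ext (a b : Z -> C) (s : C) :
  (forall j, a j = b j) -> is_bilateral_series a s -> is_bilateral_series b s.
Proof.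
intros E (sp & sn & Hp & Hn & ->).
exists sp, sn; split; [|split; [|reflexivity]].
- now apply (is_series_ext _ _ _ (fun n => E _)).
- now apply (is_series_ext _ _ _ (fun n => E _)).
Qed.

Lemma is_bilateral_series_scal (c : C) (a : Z -> C) (s : C) :
  is_bilateral_series a s -> is_bilateral_series (fun j => c * a j)%C (c * s)%C.
Proof.
intros (sp & sn & Hp & Hn & ->).
exists (c * sp)%C, (c * sn)%C; split; [|split; [|ring]].
- exact (is_series_scal (V := C_NormedModule) c _ _ Hp).
- exact (is_series_scal (V := C_NormedModule) c _ _ Hn).
Qed.

Lemma is_bilateral_series_reflect (a : Z -> C) (s : C) :
  is_bilateral_series a s -> is_bilateral_series (fun j => a (- j)%Z) s.
Proof.
intros (sp & sn & Hp & Hn & ->).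
(* The halves swap, but the term of index 0 must remain in the nonnegative one. *)
exists (a 0%Z + sn)%C, (sp - a 0%Z)%C; split; [|split; [|ring]].
- apply (is_series_decr_1 (V := C_NormedModule)).
  change (is_series (V := C_NormedModule) (fun n => a (- Z.of_nat (S n))%Z)
    ((a 0%Z + sn) + - a 0%Z)%C).
  now replace ((a 0%Z + sn) + - a 0%Z)%C with sn by ring.
- apply (is_series_ext (V := C_NormedModule) (fun n => a (Z.of_nat (S n)))).
  { intros n; now rewrite Z.opp_involutive. }
  apply (is_series_incr_1 (V := C_NormedModule) (fun n => a (Z.of_nat n))).
  change (is_series (V := C_NormedModule) (fun n => a (Z.of_nat n))
    (sp - a 0%Z + a 0%Z)%C).
  now replace (sp - a 0%Z + a 0%Z)%C with sp by ring.
Qed.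

Lemma is_bilateral_series_shift (a : Z -> C) (s : C) :
  is_bilateral_series a s -> is_bilateral_series (fun j => a (j + 1)%Z) s.
Proof.
intros (sp & sn & Hp & Hn & ->).
(* The term [a 0] now sits at index -1, so it passes to the negative half. *)
exists (sp - a 0%Z)%C, (a 0%Z + sn)%C; split; [|split; [|ring]].
- apply (is_series_ext (V := C_NormedModule) (fun n => a (Z.of_nat (S n)))).
  { intros n; f_equal; lia. }
  apply (is_series_incr_1 (V := C_NormedModule) (fun n => a (Z.of_nat n))).
  change (is_series (V := C_NormedModule) (fun n => a (Z.of_nat n))
    (sp - a 0%Z + a 0%Z)%C).
  now replace (sp - a 0%Z + a 0%Z)%C with sp by ring.
- apply (is_series_decr_1 (V := C_NormedModule)).
  apply (is_series_ext (V := C_NormedModule) (fun n => a (- Z.of_nat (S n))%Z)).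
  { intros n; f_equal; lia. }
  change (is_series (V := C_NormedModule) (fun n => a (- Z.of_nat (S n))%Z)
    ((a 0%Z + sn) + - a 0%Z)%C).
  now replace ((a 0%Z + sn) + - a 0%Z)%C with sn by ring.
Qed.

(** * Summability, nonvanishing and the two identities *)

(** The value chosen by [iota] can be used only once a sum exists. The negative half is the
    nonnegative half at $1-z$, where the excluded point $-1/\phi$ corresponds to $z = \phi$. *)
Lemma fibonacci_eisenstein_correct (k : nat) (z : C) :
  (1 <= k)%nat -> z <> RtoC golden -> z <> (- / RtoC golden)%C ->
  is_bilateral_series (fun j => / fib_lin z j ^ (2 * k))%C
    (fibonacci_eisenstein (2 * k) z).
Proof.
intros Hk Hphi Hphi'.
assert (Hw : (1 - z)%C <> (- / RtoC golden)%C).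
{ rewrite opp_inv_golden; intros E; apply Hphi.
  transitivity (1 - (1 - z))%C; [ring | rewrite E; ring]. }
destruct (ex_series_fib_lin (2 * k) z ltac:(lia) Hphi') as [sp Hp].
destruct (ex_series_fib_lin (2 * k) (1 - z) ltac:(lia) Hw) as [sn Hn].
apply (is_series_ext (V := C_NormedModule) _
  (fun n => / fib_lin z (- Z.of_nat n) ^ (2 * k))%C) in Hn.
2:{ intros n; now rewrite fib_lin_compl, Cpow_even_sign by apply signC_sqr. }
(* The sum [sn] starts at index 0, which [sp] already counts; that term is subtracted. *)
assert (S : is_bilateral_series (fun j => / fib_lin z j ^ (2 * k))%C
  (sp + (sn - / fib_lin z 0 ^ (2 * k)))%C).
{ exists sp, (sn - / fib_lin z 0 ^ (2 * k))%C; split; [exact Hp | split; [|reflexivity]].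
  apply (is_series_incr_1 (V := C_NormedModule)
    (fun n => / fib_lin z (- Z.of_nat n) ^ (2 * k))%C).
  change (is_series (V := C_NormedModule)
    (fun n => / fib_lin z (- Z.of_nat n) ^ (2 * k))%C
    (sn - / fib_lin z 0 ^ (2 * k) + / fib_lin z 0 ^ (2 * k))%C).
  assert (E : forall u v : C, (u - v + v)%C = u) by (intros; ring).
  now rewrite E. }
change (fibonacci_eisenstein (2 * k) z) with
  (bilateral_series (fun j => / fib_lin z j ^ (2 * k))%C).
now rewrite (is_bilateral_series_unique _ _ S).
Qed.

Lemma fibZ_neq0 (n : Z) : n <> 0%Z -> fibZ n <> 0%Z.
Proof.
(* Nonnegativity of the previous term is carried along so that strict positivity passes through the
   recurrence. *)
assert (P : forall m : nat, (0 <= fib m /\ 0 < fib (S m))%Z).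
{ induction m as [|m IH]; [now split|].
  change (fib (S (S m))) with (fib (S m) + fib m)%Z; lia. }
assert (Q : forall p : Z, (0 < p)%Z -> fibZ p <> 0%Z).
{ intros p Hp; replace p with (Z.of_nat (S (Z.to_nat (p - 1)))) by lia.
  rewrite fibZ_nat; specialize (P (Z.to_nat (p - 1))); lia. }
intros Hn; destruct (Z.lt_trichotomy n 0) as [H | [H | H]]; [|easy|now apply Q].
intros E; apply (Q (- n)%Z); [lia|].
rewrite fibZ_opp, E; ring.
Qed.

(** Index 0 stands apart because the form is there the constant 1; every other form has a single
    zero, which is one of the excluded quotients. *)
Lemma fib_lin_neq0 (z : C) (j : Z) :
  (forall n : Z, fibZ (n - 1) <> 0%Z -> z <> (fibC n / fibC (n - 1))%C) ->
  fib_lin z j <> 0.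
Proof.
intros hfib E; destruct (Z.eq_dec j 0) as [-> | Hj].
{ rewrite fib_lin_0 in E; apply RtoC_inj in E; lra. }
assert (H : fibC (- j) <> 0).
{ intros F; apply RtoC_inj, eq_IZR in F; revert F; apply fibZ_neq0; lia. }
(* The zero -F_{j-1}/F_j of [fib_lin z j] is F_{1-j}/F_{-j}. *)
assert (Ej : (fibC (1 - j) - fibC (- j) * z = 0)%C).
{ replace (1 - j)%Z with (- (j - 1))%Z by lia.
  rewrite !fibC_opp, signC_pred.
  transitivity (- signC j * fib_lin z j)%C; [unfold fib_lin; ring | rewrite E; ring]. }
apply (hfib (1 - j)%Z); replace (1 - j - 1)%Z with (- j)%Z by lia.
- apply fibZ_neq0; lia.
- transitivity ((fibC (1 - j) - (fibC (1 - j) - fibC (- j) * z)) / fibC (- j))%C;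
    [field; exact H | rewrite Ej; field; exact H].
Qed.

Theorem theorem1 (k : nat) (hk : (1 <= k)%nat) (z : C)
  (hphi : z <> RtoC golden)
  (hphi' : z <> (- / RtoC golden)%C)
  (hfib : forall n : Z, fibZ (n - 1) <> 0%Z -> z <> (fibC n / fibC (n - 1))%C) :
  (fibonacci_eisenstein (2 * k) (- / z)%C =
     z ^ (2 * k) * fibonacci_eisenstein (2 * k) z)%C
  /\
  fibonacci_eisenstein (2 * k) (1 - z)%C = fibonacci_eisenstein (2 * k) z.
Proof.
pose proof (fibonacci_eisenstein_correct k z hk hphi hphi') as S.
(* By uniqueness of sums, it suffices that each right-hand side sums the transformed series. *)
split; apply is_bilateral_series_unique.
(* The value 0 is the excluded quotient $F_0/F_{-1} = 0/1$. *)
- assert (Hz : z <> 0).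
  { intros ->; apply (hfib 0%Z); [discriminate|].
    change (RtoC 0 = 0 / 1)%C; field. }
  (* Shifting first and then reflecting yields the substitution $j \mapsto 1-j$. *)
  apply is_bilateral_series_shift, is_bilateral_series_reflect in S.
  apply (is_bilateral_series_scal (z ^ (2 * k))%C) in S.
  revert S; apply is_bilateral_series_ext; intros j.
  change (z ^ (2 * k) * / fib_lin z (- j + 1) ^ (2 * k) =
    / fib_lin (- / z) j ^ (2 * k))%C.
  assert (Hj := fib_lin_neq0 z (- j + 1) hfib).
  rewrite fib_lin_opp_inv by exact Hz.
  replace (1 - j)%Z with (- j + 1)%Z by lia.
  unfold Cdiv; rewrite <- Cmult_assoc, Cpow_even_sign by apply signC_sqr.
  rewrite Cpow_mult_l, Cpow_inv by exact Hz.
  field; split; now apply Cpow_nz.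
- apply is_bilateral_series_reflect in S.
  revert S; apply is_bilateral_series_ext; intros j.
  change (/ fib_lin z (- j) ^ (2 * k) = / fib_lin (1 - z) j ^ (2 * k))%C.
  now rewrite fib_lin_compl, Cpow_even_sign by apply signC_sqr.
Qed.
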